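(* Let $X$ be a continuum such that $\mathcal{T}\colon 2^X\to 2^X$ is continuous. Then $X$ is decomposable if and only if $\mathcal{T}(\{p\})$ has empty interior in $X$ for each $p\in X$.
   Context: A continuum is a compact, connected, nonempty metric space; a subcontinuum of $X$ is a subset of $X$ that is a continuum. A continuum is decomposable if it is the union of two proper subcontinua, and indecomposable otherwise. For a continuum $X$, $2^X$ denotes the set of all nonempty closed subsets of $X$ with the Hausdorff metric. Jones' set function $\mathcal{T}$ is defined for every $A\subseteq X$ by $$\mathcal{T}(A)=X\setminus\{x\in X : \text{there is a subcontinuum } W \text{ of } X \text{ with } x\in W^{\circ}\subseteq W\subseteq X\setminus A\},$$ where $W^\circ$ is the interior of $W$ in $X$. If $A\in 2^X$ then $\mathcal{T}(A)\in 2^X$, and continuity of $\mathcal{T}$ refers to its restriction $2^X\to 2^X$. *)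

(* Defs.v *)
From HB Require Import structures.
From mathcomp Require Import all_boot all_order all_algebra.
From mathcomp Require Import boolp classical_sets reals topology.

Set Implicit Arguments.
Unset Strict Implicit.
Unset Printing Implicit Defensive.

Import Order.TTheory GRing.Theory Num.Theory.

Local Open Scope classical_set_scope.
Local Open Scope ring_scope.

Definition subcontinuum (X : topologicalType) (W : set X) : Prop :=
  [/\ W !=set0, compact W & connected W].

Definition continuum (R : realType) (X : metricType R) : Prop :=
  subcontinuum [set: X].

Definition decomposable (X : topologicalType) : Prop :=
  exists U V : set X,
    [/\ subcontinuum U, subcontinuum V, U != [set: X], V != [set: X]
      & U `|` V = [set: X]].

Definition jonesT (X : topologicalType) (A : set X) : set X :=
  ~` [set x | exists W : set X,
        [/\ subcontinuum W, W° x, W° `<=` W & W `<=` ~` A]].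

Definition thickening (R : realType) (X : metricType R) (e : R) (A : set X)
    : set X :=
  [set x | exists2 a, A a & mdist x a < e].

Definition hausdorff_dist (R : realType) (X : metricType R) (A B : set X) : R :=
  inf [set e | [/\ 0 < e, A `<=` thickening e B & B `<=` thickening e A]].

(* The parameter cX is part of the type because hausdorff_dist is a metric only
   when X is bounded: inf is 0 on the empty set. *)
Record hyperspace (R : realType) (X : metricType R) (cX : continuum X) :=
  Hyperspace {
    hset :> set X ;
    hset_nonempty : hset !=set0 ;
    hset_closed : closed hset }.

Section hyperspace_metric.
Context {R : realType} {X : metricType R} (cX : continuum X).

HB.instance Definition _ := gen_eqMixin (hyperspace cX).
HB.instance Definition _ := gen_choiceMixin (hyperspace cX).

Let hset_inj (A B : hyperspace cX) : hset A = hset B -> A = B.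
Proof.
case: A B => [A A0 Ac] [B B0 Bc] /= AB; subst B.
by rewrite (Prop_irrelevance A0 B0) (Prop_irrelevance Ac Bc).
Qed.

Let hdist (A B : hyperspace cX) : R := hausdorff_dist A B.

Let radii (A B : set X) : set R :=
  [set e | [/\ 0 < e, A `<=` thickening e B & B `<=` thickening e A]].

Let bounded : exists2 M : R, 0 < M & forall x y : X, mdist x y < M.
Proof.
have [[x0 _] cptX _] := cX.
have [|N _ ltN] := (compact_near_coveringP _).1 cptX nat \oo
    (fun n x => mdist x0 x < n%:R) _.
  move=> x _; exists (ball x 1, [set n | (Num.truncn (mdist x0 x + 1) < n)%N]).
    by split; [exact: nbhsx_ballx|exists (Num.truncn (mdist x0 x + 1)).+1].
  case=> y n [/=]; rewrite ballEmdist /= => xy mn.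
  rewrite (le_lt_trans (metric_triangle x0 x y))//.
  apply: (@lt_trans _ _ (mdist x0 x + 1)); first by rewrite ltrD2l.
  by rewrite (lt_le_trans (truncnS_gt _))// ler_nat.
have {}ltN x : mdist x0 x < N.+1%:R by apply: (ltN N.+1) => /=.
exists (N.+1%:R + N.+1%:R); first by rewrite addr_gt0// ltr0n.
move=> x y; rewrite (le_lt_trans (metric_triangle x x0 y))// ltrD//.
by rewrite metric_sym.
Qed.

Let has_inf_radii (A B : hyperspace cX) : has_inf (radii A B).
Proof.
split; last by exists 0 => e [/ltW].
have [M M0 ltM] := bounded.
have [a Aa] := hset_nonempty A; have [b Bb] := hset_nonempty B.
by exists M; split => // x _; [exists b|exists a].
Qed.

Let hdistxx A : hdist A A = 0.
Proof.
apply/eqP; rewrite eq_le; apply/andP; split; last first.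
  apply: lb_le_inf; first by case: (has_inf_radii A A).
  by move=> e [/ltW].
apply/ler_addgt0Pl => e e0; rewrite addr0; apply: ge_inf.
  by case: (has_inf_radii A A).
by split => // x Ax; exists x => //; rewrite mdistxx.
Qed.

Let hdist_sym A B : hdist A B = hdist B A.
Proof.
by congr inf; apply/seteqP; split => e [? ? ?]; split.
Qed.

Let hdist0_sub A B : hdist A B = 0 -> A `<=` B.
Proof.
move=> AB0 x Ax; apply: (hset_closed (h := B)) => U /nbhs_ballP[e /= e0 eU].
have [r [r0 AB _]] := inf_adherent e0 (has_inf_radii A B).
rewrite [inf _]AB0 add0r => re.
have [b Bb xb] := AB _ Ax; exists b; split => //; apply: eU.
by rewrite ballEmdist /= (lt_trans xb).
Qed.

Let hdist_positivity A B : hdist A B = 0 -> A = B.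
Proof.
move=> AB; apply/hset_inj/seteqP; split; apply: hdist0_sub => //.
by rewrite hdist_sym.
Qed.

Let thickening_trans (A B C : set X) r s :
  A `<=` thickening r B -> B `<=` thickening s C -> A `<=` thickening (r + s) C.
Proof.
move=> AB BC x /AB[b /BC[c Cc bc] xb]; exists c => //.
by rewrite (le_lt_trans (metric_triangle x b c))// ltrD.
Qed.

Let hdist_triangle B A C : hdist A C <= hdist A B + hdist B C.
Proof.
apply/ler_addgt0Pl => e e0.
have e20 : 0 < e / 2 by rewrite divr_gt0.
have [r [r0 AB BA] re] := inf_adherent e20 (has_inf_radii A B).
have [s [s0 BC CB] se] := inf_adherent e20 (has_inf_radii B C).
rewrite [e]splitr addrC addrACA.
apply: le_trans (ltW (ltrD re se)); apply: ge_inf.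
  by case: (has_inf_radii A C).
split; [exact: addr_gt0|exact: thickening_trans AB BC|].
by rewrite addrC; exact: thickening_trans CB BA.
Qed.

HB.instance Definition _ := isMetric.Build R (hyperspace cX)
  hdistxx hdist_positivity hdist_sym hdist_triangle.

End hyperspace_metric.

Lemma sub_jonesT (X : topologicalType) (A : set X) : A `<=` jonesT A.
Proof.
by move=> x Ax [W [_ xW WW WA]]; exact: (WA x (WW x xW)).
Qed.

Lemma closed_jonesT (X : topologicalType) (A : set X) : closed (jonesT A).
Proof.
apply: open_closedC; rewrite openE => x [W [cW xW WW WA]].
rewrite /interior; have := open_interior W; rewrite openE => /(_ x xW).
by apply: filterS => y yW; exists W.
Qed.

Section jonesT_hyperspace.
Context {R : realType} {X : metricType R} (cX : continuum X).

Let jonesT_nonempty (A : hyperspace cX) : jonesT A !=set0.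
Proof. by have [a Aa] := hset_nonempty A; exists a; exact: sub_jonesT. Qed.

Definition hyperT (A : hyperspace cX) : hyperspace cX :=
  Hyperspace cX (jonesT_nonempty A) (@closed_jonesT X A).

End jonesT_hyperspace.

Arguments hyperT {R X} cX A.

(* Main.v *)
Require Import Defs.
From mathcomp Require Import all_boot all_order all_algebra.
From mathcomp Require Import boolp classical_sets reals topology.

(**
  Write [T x] for [jonesT [set x]].  Continuity gives, for a subcontinuum [W]
  (approximate the closure of its complement by finite sets missing [W]), that
  [jonesT (~` W°) = ~` W°]; in particular [T] is idempotent.

  The heart is the symmetry of the relation [T x y].  Let [L] be the closed set
  of the [y] with [T y] minimal.  Every [T b] meets [L], and [b |-> T b `&` L]
  is again continuous, so that, [X] being connected, [L] is connected and
  [~` W°] is connected for every subcontinuum [W] missing [L].  If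
  [p \in W°] and [q \in T p `&` L] is not in [W], then [~` W°] cannot be
  connected, otherwise it would be a subcontinuum witnessing [q \notin T p].
  Hence [jonesT L = setT], and if some [p] is not in [L], then [~` W°] splits for
  some [W], which provides two points [q], [l] of [L] such that
  [jonesT [set q; l]] is the disjoint union of [T q] and [T l].
  Since [L] is connected, such additivity spreads from one pair to all pairs of
  points of [L], then to all finite subsets of [L], and by continuity
  [jonesT L `<=` L], a contradiction.  So [L = setT] and the sets [T x] partition
  [X]; by lower semicontinuity a [T p] with nonempty interior is open, hence is
  everything, and then every subcontinuum with nonempty interior is all of [X].
*)

Set Implicit Arguments.
Unset Strict Implicit.
Unset Printing Implicit Defensive.

Import Order.TTheory GRing.Theory Num.Theory.
Local Open Scope classical_set_scope.

(** * Splittings of closed sets *)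

Section splitting.
Context {X : topologicalType}.
Implicit Types A B C E K U V W Y Z : set X.

(** Either piece may be empty, so a closed set always splits trivially; nonemptiness is required
    separately. *)
Definition splits Y C E :=
  [/\ closed C, closed E, C `&` E = set0 & Y = C `|` E].

Lemma splitsC Y C E : splits Y C E -> splits Y E C.
Proof. by case=> cC cE CE0 ->; split=> //; rewrite 1?setIC 1?setUC. Qed.

Lemma splits_disj Y C E x : splits Y C E -> C x -> E x -> False.
Proof. by case=> _ _ CE _ Cx Ex; have : (C `&` E) x by []; rewrite CE. Qed.

Lemma connected_sub_splits Y C E K : splits Y C E -> connected K ->
  K `<=` Y -> K `&` C !=set0 -> K `<=` C.
Proof.
move=> [cC cE CE ->] conK KY KC; suff <- : K `&` C = K by exact: subIsetr.
apply: conK => //; last by exists C.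
exists (~` E); first exact: closed_openC.
apply/seteqP; split=> x [Kx]; last by case: (KY x Kx).
by move=> Cx; split=> // Ex; have : (C `&` E) x by []; rewrite CE.
Qed.

Lemma disconnected_splits Y : closed Y -> ~ connected Y ->
  exists C E, [/\ splits Y C E, C !=set0 & E !=set0].
Proof.
move=> cY; rewrite /connected => /existsNP[B /not_implyP[B0]].
move=> /not_implyP[[O oO BO]] /not_implyP[[F cF BF]] BY.
exists B, (Y `\` O); split=> //.
- split; first by rewrite BF; exact: closedI.
  + by rewrite setDE; apply: closedI => //; exact: open_closedC.
  + by rewrite BO; apply/seteqP; split=> // x [[_ Ox] [_ /(_ Ox)]].
  + rewrite BO; apply/seteqP; split=> [x Yx|x [[]|[]]//].
    by have [Ox|Ox] := pselect (O x); [left|right].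
- apply: contrapT => /set0P/negP/negPn/eqP YO0; apply: BY; rewrite BO.
  apply/seteqP; split=> [x []//|x Yx]; split=> //; apply: contrapT => Ox.
  by have : (Y `\` O) x by []; rewrite YO0.
Qed.

Lemma connected_closedP Y : closed Y ->
  (forall C E, splits Y C E -> C !=set0 -> E !=set0 -> False) -> connected Y.
Proof.
move=> cY h; apply: contrapT => /(disconnected_splits cY)[C [E [CE C0 E0]]].
exact: h CE C0 E0.
Qed.

Lemma splits_not_connected Y C E : splits Y C E -> C !=set0 -> E !=set0 ->
  ~ connected Y.
Proof.
move=> CE [c Cc] [e Ee] conY; apply: (splits_disj CE _ Ee).
have [_ _ _ YE] := CE.
apply: (connected_sub_splits CE conY) => //; last by rewrite YE; right.
by exists c; rewrite YE; split=> //; left.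
Qed.

(** Compactness as an induction principle: if no [U] with [P U] covered [A], what such [U] leave of
    [A] would generate a proper filter without a cluster point in [A]. *)
Lemma compact_finite_ind A (P : set X -> Prop) : compact A -> P set0 ->
  (forall U V, P U -> P V -> P (U `|` V)) ->
  (forall x, A x -> exists2 U, nbhs x U & P U) ->
  exists2 U, P U & A `<=` U.
Proof.
move=> cA P0 PU Px; apply: contrapT => nP.
pose F S := exists2 U, P U & A `\` U `<=` S.
have FF : Filter F.
  split; first by exists set0.
    move=> S S' [U PU1 US] [V PV VS]; exists (U `|` V); first exact: PU.
    by move=> x [Ax /not_orP[Ux Vx]]; split; [exact: US|exact: VS].
  by move=> S S' SS' [U PU1 US]; exists U => //; exact: subset_trans US SS'.
have PF : ProperFilter F.
  split=> // -[U PU1 AU0]; apply: nP; exists U => // x Ax.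
  by apply: contrapT => Ux; exact: (AU0 x).
have [|x [Ax clx]] := cA F PF; first by exists set0 => // x [].
have [U xU PU1] := Px x Ax.
have [|y [[_ nUy] Uy]] := clx (A `\` U) U _ xU; first by exists U.
exact: nUy.
Qed.

(* Each step throws away, together with one half of a splitting of [Z], at
   least one of the marked points [s]. *)
Lemma finitely_many_pieces (s : seq X) Z x : closed Z -> Z x ->
  (forall C E, splits Z C E -> C !=set0 -> exists2 y, y \in s & C y) ->
  exists2 K, K x & connected K /\ exists E, splits Z K E.
Proof.
move: {2}(size s) (leqnn (size s)) => n.
elim: n s Z => [|n ih] s Z; rewrite ?leqn0 => sn cZ Zx hs.
  (* With no marked point left, the trivial splitting of [Z] already demands one. *)
  have [|y] := hs Z set0 _ (ex_intro _ x Zx).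
    by split=> //; rewrite ?setI0 ?setU0//; exact: closed0.
  by rewrite (size0nil (eqP sn)).
have [conZ|/(disconnected_splits cZ)] := pselect (connected Z).
  exists Z => //; split=> //; exists set0.
  by split=> //; rewrite ?setI0 ?setU0//; exact: closed0.
move=> [C0 [E0 [CE0 C0n E0n]]].
wlog Cx : C0 E0 CE0 C0n E0n / C0 x.
  move=> h; have [_ _ _ ZE] := CE0; move: (Zx); rewrite {1}ZE => -[]; first exact: (h C0 E0).
  exact: (h E0 C0 (splitsC CE0)).
have [y ys E0y] := hs _ _ (splitsC CE0) E0n.
have [cC cE CE ZE] := CE0.
have glue C E : splits C0 C E -> splits Z C (E `|` E0).
  move=> [cC' cE' CE' C0E]; split=> //; first exact: closedU.
    rewrite setIUr CE' set0U; apply/seteqP; split=> // z [Cz Ez].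
    by rewrite -CE; split=> //; rewrite C0E; left.
  by rewrite ZE C0E setUA.
have [||||K Kx [conK [E KE]]] := ih (rem y s) C0 => //.
- have s0 : (0 < size s)%N by rewrite lt0n size_eq0; apply: contraTneq ys => ->.
  by rewrite size_rem// -ltnS prednK.
- move=> C E SCE Cn; have [z zs Cz] := hs _ _ (glue _ _ SCE) Cn; exists z => //.
  have zy : z != y.
    apply/eqP => zy; apply: (splits_disj CE0 _ E0y); rewrite -zy.
    by case: SCE => _ _ _ ->; left.
  by move: zs; rewrite (perm_mem (perm_to_rem ys)) inE (negPf zy).
- by exists K => //; split=> //; exists (E `|` E0); exact: glue.
Qed.

End splitting.

(** * Jones' set function on a Hausdorff continuum *)

Section jonesT_continuum.
Context {X : topologicalType}.
Hypothesis hX : hausdorff_space X.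
Hypothesis cX : subcontinuum [set: X].
Implicit Types A B C E K U V W Y Z S : set X.

Lemma jonesT_notin A x : ~ jonesT A x <->
  exists W, [/\ subcontinuum W, W° x & W `<=` ~` A].
Proof.
split=> [/contrapT[W [cW xW _ WA]]|[W [cW xW WA]]]; first by exists W.
by apply; exists W; split=> //; exact: interior_subset.
Qed.

Lemma jonesTS A B : A `<=` B -> jonesT A `<=` jonesT B.
Proof.
move=> AB x Ax; apply: contrapT => /jonesT_notin[W [cW xW WB]].
suff : ~ jonesT A x by []; apply/jonesT_notin; exists W; split=> //.
by apply: subset_trans WB _; exact: subsetC.
Qed.

Lemma closed_subcontinuum W : closed W -> W !=set0 -> connected W ->
  subcontinuum W.
Proof.
move=> cW W0 conW; split=> //; have [_ cptX _] := cX.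
exact: subclosed_compact cptX _.
Qed.

Lemma subcontinuum_closed W : subcontinuum W -> closed W.
Proof. by case=> _ + _; exact: compact_closed. Qed.

Lemma closed_compactX A : closed A -> compact A.
Proof. by have [_ cptX _] := cX => cA; exact: subclosed_compact cptX _. Qed.

Lemma separate_closed C E : closed C -> closed E -> C `&` E = set0 ->
  exists U V, [/\ open U, open V, C `<=` U, E `<=` V & U `&` V = set0].
Proof.
move=> cC cE CE; have [_ cptX _] := cX.
have [|U /set_nbhsP[U' [oU' CU' U'U]] UE] :=
    compact_normal hX cptX cC (_ : set_nbhs C (~` E)).
  apply/set_nbhsP; exists (~` E); split=> //; first exact: closed_openC.
  by apply/disjoints_subset.
exists U', (~` closure U); split=> //.
- by apply: closed_openC; exact: closed_closure.
- by move=> x Ex /UE; apply.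
- apply/seteqP; split=> // x [/U'U Ux]; apply; exact: subset_closure.
Qed.

Lemma jonesT0 : jonesT (@set0 X) = set0.
Proof.
apply/seteqP; split=> // x; apply: (jonesT_notin set0 x).2; exists setT.
by split=> //; [exact: filterT|move=> ? _ []].
Qed.

(* Surround [E] by an open [U] missing [C] and cover the frontier of [U] by
   finitely many subcontinua missing [A]; adding them to the part of [W] in the
   closure of [U] gives a set each of whose clopen pieces contains one of them. *)
Lemma jonesT_splits A C E : splits (jonesT A) C E -> E `<=` jonesT (A `&` E).
Proof.
move=> CE x Ex; have [cC cE CE0 TA] := CE; apply: contrapT.
move=> /jonesT_notin[W [cW xW WAE]].
have [O [U [oO oU CO EU OU]]] := separate_closed cC cE CE0.
have UO : U `<=` ~` O by move=> y Uy Oy; have : (O `&` U) y by []; rewrite OU.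
have TAx : jonesT A x by rewrite TA; right.
have WOA : W `&` ~` O `<=` ~` A.
  move=> y [Wy Oy] Ay; have := sub_jonesT Ay; rewrite TA => -[/CO//|Ey].
  exact: (WAE y Wy).
have WU : ~ (W `<=` U).
  move=> WU; suff : ~ jonesT A x by []; apply/jonesT_notin; exists W; split=> //.
  by move=> y Wy; apply: WOA; split=> //; exact/UO/WU.
(* Stands for a cover of [V] by finitely many subcontinua missing [A], in the form used below: each
   point of [Z] is joined inside [Z] to a marked point. *)
pose P V := exists Z (s : seq X), [/\ closed Z, V `<=` Z, Z `<=` ~` A &
  forall z, Z z -> exists K, [/\ connected K, K z, K `<=` Z &
    exists2 w, w \in s & K w]].
have cF : compact (~` O `\` U).
  apply: closed_compactX; apply: closedI; first exact: open_closedC.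
  exact: open_closedC.
have [|||F [Z [s [cZ FZ ZA Zs]]] UF] := @compact_finite_ind _ _ P cF.
- by exists set0, [::]; split=> //; exact: closed0.
- move=> V1 V2 [Z1 [s1 [cZ1 VZ1 ZA1 Zs1]]] [Z2 [s2 [cZ2 VZ2 ZA2 Zs2]]].
  exists (Z1 `|` Z2), (s1 ++ s2); split; first exact: closedU.
  + exact: setUSS.
  + by move=> z [/ZA1|/ZA2].
  + move=> z [/Zs1|/Zs2] [K [conK Kz KZ [w ws Kw]]]; exists K; split=> //.
    * by move=> y /KZ; left.
    * by exists w => //; rewrite mem_cat ws.
    * by move=> y /KZ; right.
    * by exists w => //; rewrite mem_cat ws orbT.
- move=> y [Oy Uy].
  have [|V [cV yV VA]] := (jonesT_notin A y).1.
    by rewrite TA => -[/CO|/EU].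
  exists V => //; exists V, [:: y]; split=> //; first exact: subcontinuum_closed.
  move=> z Vz; exists V; split=> //; first by case: cV.
  by exists y; [rewrite inE|exact: interior_subset].
have {}FZ : ~` O `\` U `<=` Z by exact: subset_trans FZ.
have Ux : U x by exact: EU.
have [|||K Kx [conK [E1 KE1]]] :=
  @finitely_many_pieces _ s ((W `&` ~` O) `|` Z) x.
- apply: closedU => //; apply: closedI; first exact: subcontinuum_closed.
  exact: open_closedC.
- by left; split; [exact: interior_subset|exact: UO].
(* A piece without marked points avoids [Z], hence lies in both [W] and [U] and is clopen in [W];
   connectedness then puts all of [W] inside [U]. *)
- move=> C1 E1 CE1 [c Cc]; apply: contrapT => nC.
  have C1Z z : C1 z -> ~ Z z.
    move=> C1z /Zs[V [conV Vz VZ [w ws Vw]]]; apply: nC; exists w => //.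
    apply: (connected_sub_splits CE1 conV _ _ Vw); last by exists z.
    by move=> y /VZ; right.
  have [cC1 cE1 CE10 ZE] := CE1.
  have C1W : C1 `<=` W `&` ~` O.
    move=> z C1z; have : (W `&` ~` O `|` Z) z by rewrite ZE; left.
    by case=> // /(C1Z _ C1z).
  have C1U : C1 `<=` U.
    move=> z C1z; apply: contrapT => Uz; apply: (C1Z z C1z); apply: FZ.
    by split=> //; case: (C1W _ C1z).
  apply: WU; apply: (subset_trans _ C1U).
  have [_ _ conW] := cW; have clW := subcontinuum_closed cW.
  have sW : splits W C1 (W `&` E1 `|` W `\` U).
    split=> //.
    + apply: closedU; first exact: closedI.
      by apply: closedI => //; exact: open_closedC.
    + apply/seteqP; split=> // z [C1z [[_ E1z]|[_]]]; last by apply; exact: C1U.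
      exact: splits_disj CE1 C1z E1z.
    + apply/seteqP; split=> [z Wz|z [/C1W[]//|[[]//|[]//]]].
      have [Uz|Uz] := pselect (U z); last by right; right.
      have : (C1 `|` E1) z by rewrite -ZE; left; split=> //; exact: UO.
      by case; [left|right; left].
  by apply: (connected_sub_splits sW conW) => //; exists c; split=> //;
    case: (C1W _ Cc).
suff : ~ jonesT A x by []; apply/jonesT_notin; have [cK cE1 KE10 ZK] := KE1.
exists K; split.
- by apply: closed_subcontinuum => //; exists x.
- have E1x : ~ E1 x by move=> ?; exact: splits_disj KE1 Kx _.
  rewrite /interior; near=> y.
  have : (K `|` E1) y.
    rewrite -ZK; left; split; last apply: UO; near: y; last exact: open_nbhs_nbhs.
    exact: xW.
  case=> // E1y; suff : (~` E1) y by [].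
  by near: y; apply: open_nbhs_nbhs; split=> //; exact: closed_openC.
- move=> y Ky; have : (W `&` ~` O `|` Z) y by rewrite ZK; left.
  by case=> [/WOA|/ZA].
Unshelve. all: by end_near. Qed.

Lemma jonesT_splits_eq0 A C E : splits (jonesT A) C E -> A `<=` C -> E = set0.
Proof.
move=> CE AC; have := jonesT_splits CE.
suff -> : A `&` E = set0 by rewrite jonesT0 subset0.
apply/seteqP; split=> // x [/AC Cx Ex]; exact: splits_disj CE Cx Ex.
Qed.

(** A piece not containing [x] would lie in [jonesT set0], which is empty. *)
Lemma connected_jonesT1 (x : X) : connected (jonesT [set x]).
Proof.
apply: connected_closedP => [|C E CE [c Cc] [e Ee]]; first exact: closed_jonesT.
have [_ _ _ TE] := CE; have : jonesT [set x] x by exact: sub_jonesT.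
rewrite TE => -[Cx|Ex].
- have E0 := jonesT_splits_eq0 CE (_ : [set x] `<=` C).
  by move: Ee; rewrite E0// => _ ->.
- have C0 := jonesT_splits_eq0 (splitsC CE) (_ : [set x] `<=` E).
  by move: Cc; rewrite C0// => _ ->.
Qed.

(** A subcontinuum missing [l] and [S] also misses every [l'] near [l], and the interiors of
    finitely many such subcontinua cover the complement of [U]. *)
Lemma jonesT_usc S (l : X) U : open U -> jonesT (l |` S) `<=` U ->
  \forall l' \near l, jonesT (l' |` S) `<=` U.
Proof.
move=> oU TU.
pose P V := \forall l' \near l, V `&` jonesT (l' |` S) = set0.
have cU : compact (~` U) by apply: closed_compactX; exact: open_closedC.
have [|||V PV UV] := @compact_finite_ind _ _ P cU.
- by rewrite /P; near=> l'; rewrite set0I.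
- move=> V1 V2; rewrite /P; apply: filterS2 => l' V10 V20.
  by rewrite setIUl V10 V20 setU0.
- move=> y Uy; have [/TU//|/jonesT_notin[W [cW yW WS]]] :=
    pselect (jonesT (l |` S) y).
  exists W°; first exact: nbhs_interior.
  have oW : open (~` W) by apply: closed_openC; exact: subcontinuum_closed.
  have : nbhs l (~` W).
    by apply: open_nbhs_nbhs; split=> // /WS; apply; left.
  apply: filterS => l' Wl'; apply/seteqP; split=> // z [zW].
  apply: (jonesT_notin _ z).2; exists W; split=> // w Ww [/= wl'|Sw].
    by apply: Wl'; rewrite -wl'.
  by apply: (WS w Ww); right.
- move: PV; rewrite /P; apply: filterS => l' V0 z Tz; apply: contrapT => /UV Vz;
    have : (V `&` jonesT (l' |` S)) z by []; rewrite V0.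
Unshelve. all: by end_near. Qed.

End jonesT_continuum.

(** * Consequences of the continuity of Jones' set function *)

Section hyperspace_continuity.
Context {R : realType} {X : metricType R} (cX : continuum X).
Implicit Types (A B C D E K U V W Y Z S : set X) (r : R).
Local Open Scope ring_scope.

Let hX : hausdorff_space X := metric_hausdorff (T := X).

Lemma closed_set1 (x : X) : closed [set x].
Proof. by apply: compact_closed => //; exact: compact_set1. Qed.

Lemma set_seq_cons (x : X) (s : seq X) : [set` x :: s] = x |` [set` s].
Proof.
apply/seteqP; split=> y /=; first by rewrite inE => /orP[/eqP|]; [left|right].
by rewrite inE => -[->|->]; rewrite ?eqxx ?orbT.
Qed.

Lemma closed_seq (s : seq X) : closed [set` s].
Proof.
elim: s => [|x s ih]; first by rewrite set_nil; exact: closed0.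
rewrite set_seq_cons; apply: closedU ih.
exact: closed_set1.
Qed.

(** Makes the set of radii in the Hausdorff distance nonempty, so that its infimum is not the
    default value 0. *)
Lemma continuum_bounded (x0 : X) :
  exists2 M : R, 0 < M & forall x, mdist x0 x < M.
Proof.
have [_ cptX _] := cX.
pose P V := exists2 M : R, 0 < M & forall x, V x -> mdist x0 x < M.
have [|||V [M M0 VM] UV] := @compact_finite_ind _ _ P cptX.
- by exists 1.
- move=> V1 V2 [M1 M10 VM1] [M2 M20 VM2]; exists (M1 + M2); first exact: addr_gt0.
  move=> x [/VM1|/VM2] h; first by rewrite (lt_le_trans h)// lerDl ltW.
  by rewrite (lt_le_trans h)// lerDr ltW.
- move=> x _; exists (ball x 1); first exact: nbhsx_ballx.
  exists (mdist x0 x + 1); first by rewrite ltr_wpDl// mdist_ge0.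
  move=> y; rewrite ballEmdist /= => xy.
  by rewrite (le_lt_trans (metric_triangle x0 x y))// ltrD2l.
- by exists M => // x; apply: VM; exact: UV.
Qed.

Lemma hyperspace_mdist_lt (A B : hyperspace cX) e : mdist A B < e ->
  A `<=` thickening e B /\ B `<=` thickening e A.
Proof.
have [a Aa] := hset_nonempty A; have [b Bb] := hset_nonempty B.
have [M M0 aM] := continuum_bounded a.
have aM2 (x y : X) : mdist x y < M + M.
  rewrite (le_lt_trans (metric_triangle x a y))// ltrD//.
  by rewrite metric_sym.
case/inf_lt => [|r [r0 AB BA] re].
  by exists (M + M); split; [exact: addr_gt0|exists b|exists a].
by split=> [x /AB[y By xy]|x /BA[y By xy]]; exists y => //; rewrite (lt_trans xy).
Qed.

Lemma hyperspace_mdist_le (A B : hyperspace cX) r : 0 < r ->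
  A `<=` thickening r B -> B `<=` thickening r A -> mdist A B <= r.
Proof.
move=> r0 AB BA; apply: ge_inf; last by [].
by exists 0 => e [/ltW].
Qed.

(** * Lower semicontinuity and approximation by finite sets *)

Hypothesis continuousT : continuous (hyperT cX).

Lemma jonesT_lsc_hausdorff A V : closed A -> A !=set0 -> open V ->
  jonesT A `&` V !=set0 ->
  exists2 r, 0 < r & forall B, closed B -> B !=set0 ->
    A `<=` thickening r B -> B `<=` thickening r A -> jonesT B `&` V !=set0.
Proof.
move=> cA A0 oV [x [TAx Vx]]; pose hA := Hyperspace cX A0 cA.
have /nbhs_ballP[e /= e0 eV] : nbhs x V by exact: open_nbhs_nbhs.
have := continuousT (x := hA) (nbhsx_ballx (hyperT cX hA) _ e0).
(* Halving [d] turns the weak bound of [hyperspace_mdist_le] into the strict one defining the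
   ball. *)
move=> /nbhs_ballP[d /= d0 dT]; exists (d / 2); first by rewrite divr_gt0.
move=> B cB B0 AB BA; pose hB := Hyperspace cX B0 cB.
have : ball hA d hB.
  have d20 : 0 < d / 2 by rewrite divr_gt0.
  rewrite ballEmdist /=.
  apply: le_lt_trans (@hyperspace_mdist_le hA hB _ d20 AB BA) _.
  by rewrite gtr_pMr// invf_lt1// ltr1n.
move=> /dT /=; rewrite ballEmdist /= => /hyperspace_mdist_lt[/(_ x TAx)[y TBy xy] _].
by exists y; split=> //; apply: eV; rewrite ballEmdist.
Qed.

Lemma jonesT_lsc S l V : closed S -> open V -> jonesT (l |` S) `&` V !=set0 ->
  \forall l' \near l, jonesT (l' |` S) `&` V !=set0.
Proof.
move=> cS oV TV.
have cl (x : X) : closed (x |` S).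
  by apply: closedU cS; exact: closed_set1.
have n0 (x : X) : (x |` S) !=set0 by exists x; left.
have [r r0 hr] := jonesT_lsc_hausdorff (cl l) (n0 l) oV TV.
have thick (x y : X) : mdist x y < r -> x |` S `<=` thickening r (y |` S).
  move=> xy z [/= ->|Sz]; first by exists y => //; left.
  by exists z; [right|rewrite mdistxx].
near=> l'; have ll' : mdist l l' < r.
  suff : ball l r l' by rewrite ballEmdist.
  by near: l'; exact: nbhsx_ballx.
by apply: hr => //; apply: thick => //; rewrite metric_sym.
Unshelve. all: by end_near. Qed.

(** By compactness, finite subsets of the dense part [D] come arbitrarily Hausdorff-close to [A]. *)
Lemma jonesT_finite A D V : closed A -> D `<=` A -> A `<=` closure D ->
  open V -> jonesT A `&` V !=set0 ->
  exists2 s : seq X, [set` s] `<=` D & jonesT [set` s] `&` V !=set0.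
Proof.
move=> cA DA AD oV TV.
have [a Aa] : A !=set0.
  apply: contrapT => /set0P/negP/negPn/eqP A0.
  by case: TV => x []; rewrite A0 (jonesT0 cX).
have [r r0 hr] := jonesT_lsc_hausdorff cA (ex_intro _ a Aa) oV TV.
pose P U := exists2 s : seq X, [set` s] `<=` D & U `<=` thickening r [set` s].
have [|||U [s sD Us] AU] := @compact_finite_ind _ _ P (closed_compactX cX cA).
- by exists [::].
- move=> U1 U2 [s1 sD1 Us1] [s2 sD2 Us2]; exists (s1 ++ s2).
    by move=> x /=; rewrite mem_cat => /orP[/sD1|/sD2].
  by move=> x [/Us1|/Us2] [y /= ys xy]; exists y => //=; rewrite mem_cat ys ?orbT.
- move=> x Ax; have r20 : 0 < r / 2 by rewrite divr_gt0.
  have [y [Dy xy]] := AD x Ax _ (nbhsx_ballx x _ r20).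
  exists (ball x (r / 2)); first exact: nbhsx_ballx.
  exists [:: y]; first by move=> z /=; rewrite inE => /eqP ->.
  move=> z xz; exists y; first by rewrite /= inE.
  suff : ball z r y by rewrite ballEmdist.
  by rewrite [r]splitr; apply: ball_triangle xy; exact: ball_sym.
exists s => //; apply: hr; first exact: closed_seq.
- by have /AU/Us[y ys _] := Aa; exists y.
- exact: subset_trans Us.
- by move=> x /sD/DA Ax; exists x => //; rewrite mdistxx.
Qed.

Lemma jonesT_setC_interior W : subcontinuum W -> jonesT (~` W°) `<=` ~` W°.
Proof.
move=> cW x Tx Wx.
have [|||||s sW [y [Ty Wy]]] := @jonesT_finite (~` W°) (~` W) W°.
- by apply: open_closedC; exact: open_interior.
- by apply: subsetC; exact: interior_subset.
- by rewrite closure_setC.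
- exact: open_interior.
- by exists x.
suff : ~ jonesT [set` s] y by [].
by apply/jonesT_notin; exists W; split=> // z Wz /sW.
Qed.

Lemma jonesT_subC W A : subcontinuum W -> A `<=` ~` W° -> jonesT A `<=` ~` W°.
Proof.
by move=> cW AW; apply: subset_trans (jonesT_setC_interior cW); exact: jonesTS.
Qed.

(** A witness [W] that [x] is not in [jonesT A] has interior disjoint from [jonesT A], and
    [jonesT_subC] allows [jonesT] to be applied once more. *)
Lemma jonesT_idem A : jonesT (jonesT A) `<=` jonesT A.
Proof.
move=> x TTx; apply: contrapT => /jonesT_notin[W [cW xW WA]].
apply: (jonesT_subC cW _ TTx xW) => y Ty yW.
suff : ~ jonesT A y by []; by apply/jonesT_notin; exists W.
Qed.

Lemma jonesT_sub A B : A `<=` jonesT B -> jonesT A `<=` jonesT B.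
Proof. by move=> AB; apply: subset_trans (jonesT_idem (A := B)); exact: jonesTS. Qed.

Lemma jonesT1_trans (y z : X) : jonesT [set z] y ->
  jonesT [set y] `<=` jonesT [set z].
Proof. by move=> Tzy; apply: jonesT_sub => _ ->. Qed.

Lemma jonesT_setU1_eq S (x y : X) : jonesT [set x] = jonesT [set y] ->
  jonesT (x |` S) = jonesT (y |` S).
Proof.
have sub u v : jonesT [set u] = jonesT [set v] ->
    jonesT (u |` S) `<=` jonesT (v |` S).
  move=> uv; apply: jonesT_sub => z [/= ->|Sz]; last by apply: sub_jonesT; right.
  by apply: (jonesTS (A := [set v])); [exact: subsetUl|rewrite -uv; exact: sub_jonesT].
by move=> xy; apply/seteqP; split; exact: sub.
Qed.

Lemma open_jonesT_meets S V : closed S -> open V ->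
  open [set x | jonesT (x |` S) `&` V !=set0].
Proof. by move=> cS oV; rewrite openE => x Tx; exact: jonesT_lsc. Qed.

Lemma open_jonesT_sub S U : open U -> open [set x | jonesT (x |` S) `<=` U].
Proof. by move=> oU; rewrite openE => x Tx; exact: jonesT_usc. Qed.

Lemma open_jonesT1_meets V : open V ->
  open [set x | jonesT [set x] `&` V !=set0].
Proof.
move=> oV; have := open_jonesT_meets closed0 oV.
by under eq_set do rewrite setU0.
Qed.

Lemma open_jonesT1_sub U : open U -> open [set x | jonesT [set x] `<=` U].
Proof.
by move=> oU; have := @open_jonesT_sub set0 _ oU; under eq_set do rewrite setU0.
Qed.

Lemma jonesT1_sub_splits W C E c : subcontinuum W -> splits (~` W°) C E ->
  C c -> jonesT [set c] `<=` C.
Proof.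
move=> cW CE Cc; have [_ _ _ WE] := CE.
apply: (connected_sub_splits CE (connected_jonesT1 hX cX (x := c))).
  by apply: jonesT_subC => // _ ->; rewrite WE; left.
by exists c; split=> //; exact: sub_jonesT.
Qed.

Lemma setC_interior_not_connected W p q : subcontinuum W -> W° p -> ~ W q ->
  jonesT [set p] q -> ~ connected (~` W°).
Proof.
move=> cW pW qW Tpq conW; suff : ~ jonesT [set p] q by [].
apply/jonesT_notin; exists (~` W°); split.
- apply: closed_subcontinuum => //.
    by apply: open_closedC; exact: open_interior.
  by exists q => /interior_subset.
- have : open (~` W) by apply: closed_openC; exact: subcontinuum_closed.
  rewrite openE => /(_ q qW); apply: interiorS.
  by apply: subsetC; exact: interior_subset.
- by move=> y Wy /= yp; apply: Wy; rewrite yp.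
Qed.

(** * Minimal points *)

Definition minimal_points : set X :=
  [set y | forall z, jonesT [set y] z -> jonesT [set z] y].
Local Notation L := minimal_points.

Lemma minimal_eq y z : L y -> jonesT [set y] z -> jonesT [set z] = jonesT [set y].
Proof.
by move=> Ly yz; apply/seteqP; split; apply: jonesT1_trans => //; exact: Ly.
Qed.

Lemma jonesT1_minimal y : L y -> jonesT [set y] `<=` L.
Proof.
by move=> Ly z yz t zt; rewrite (minimal_eq Ly (jonesT1_trans yz zt)).
Qed.

Lemma minimal_disjoint x y : L x -> ~ jonesT [set y] x ->
  jonesT [set x] `&` jonesT [set y] = set0.
Proof.
move=> Lx yx; apply/seteqP; split=> // z [xz yz]; apply: yx.
exact: jonesT1_trans yz _ (Lx _ xz).
Qed.

(** Zorn's lemma, on complements, gives a minimal closed set that is stable under [jonesT] and meets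
    [jonesT [set b]]. For [y] in both and [z] in [jonesT [set y]], the set [jonesT [set z]] is
    another such set inside it, so it contains [y]. *)
Lemma minimal_exists b : exists2 l, L l & jonesT [set b] l.
Proof.
pose P O := [/\ open O, jonesT (~` O) `<=` ~` O &
  (~` O) `&` jonesT [set b] !=set0].
have [|A [[oA TA [y [Ay by_]]] maxA]] := @Zorn_bigcup X P.
  move=> F FP totF; split.
  - by apply: bigcup_open => O /FP[].
  - move=> x Tx [O FO Ox]; have [_ TO _] := FP _ FO.
    apply: TO Ox; apply: jonesTS Tx; apply: subsetC => z Oz; by exists O.
  - apply: contrapT => nF.
    (* The alternative [set0] starts the covering induction, where the chain may offer no member. *)
    pose Q U := exists2 O, F O \/ O = set0 & U `<=` O.
    have [|||U [O FO UO] TU] := @compact_finite_ind _ _ Q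
        (closed_compactX cX (@closed_jonesT X [set b])).
    + by exists set0; [right|].
    + move=> U1 U2 [O1 FO1 UO1] [O2 FO2 UO2].
      have [OO|OO] : O1 `<=` O2 \/ O2 `<=` O1.
        case: FO1 FO2 => [FO1|->] [FO2|->]; [exact: totF|by right|by left|by left].
      + by exists O2 => // x [/UO1/OO|/UO2].
      + by exists O1 => // x [/UO1|/UO2/OO].
    + move=> x bx; have [O FO Ox] : (\bigcup_(O in F) O) x.
        by apply: contrapT => nx; apply: nF; exists x.
      have [oO _ _] := FP _ FO.
      by exists O; [exact: open_nbhs_nbhs|exists O => //; left].
    + case: FO => [FO|O0].
        by have [_ _ [x [Ox /TU/UO]]] := FP _ FO.
      by have /TU/UO : jonesT [set b] b by [exact: sub_jonesT]; rewrite O0.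
exists y => // z yz.
have Tyz : jonesT [set z] `<=` ~` A.
  apply: subset_trans (jonesT1_trans yz) _; apply: subset_trans TA.
  by apply: jonesTS => _ ->.
apply: contrapT => zy; apply: (maxA (~` jonesT [set z])).
  by split; [move=> x Ax /Tyz|move=> /(_ y zy)].
split; first by apply: closed_openC; exact: closed_jonesT.
  by rewrite setCK; exact: jonesT_idem.
exists z; rewrite setCK; split; first exact: sub_jonesT.
exact: jonesT1_trans yz.
Qed.

(** Suppose [z] in [jonesT [set y]] violates minimality. For a minimal [y'] near [y], lower
    semicontinuity gives [z'] in [jonesT [set y']] with [jonesT [set z']] still away from [y']. *)
Lemma closed_minimal : closed L.
Proof.
move=> y cly z yz; apply: contrapT => zy.
have [|U [V [oU oV yU TV UV]]] :=
    separate_closed hX cX (closed_set1 (x := y)) (@closed_jonesT X [set z]).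
  by apply/seteqP; split=> // w /= [->].
pose N : set X := [set z' | jonesT [set z'] `<=` V].
have oO := open_jonesT1_meets (open_jonesT1_sub oV).
have nO : nbhs y ([set x | jonesT [set x] `&` N !=set0] `&` U).
  apply: open_nbhs_nbhs; split; first exact: openI.
  by split; [exists z|apply: yU].
have [y' [Ly' [[z' [y'z' Nz']] Uy']]] := cly _ nO.
have : (U `&` V) y' by split=> //; exact/Nz'/Ly'.
by rewrite UV.
Qed.

Lemma jonesT1_minimal_lsc b y V : L y -> jonesT [set b] y -> open V -> V y ->
  \forall b' \near b, exists l, [/\ L l, jonesT [set b'] l & V l].
Proof.
move=> Ly Tby oV Vy.
(* The three nested conditions give a [y'] in [jonesT [set b']] all of whose successors see [V], in
   particular a minimal successor. *)
have oO := open_jonesT1_meets (open_jonesT1_sub (open_jonesT1_meets oV)).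
apply: filterS (open_nbhs_nbhs (conj oO _)); last first.
  by exists y; split=> // z yz; exists y; split=> //; exact: Ly.
move=> b' [y' [b'y' Ty']]; have [y2 Ly2 y'y2] := minimal_exists y'.
have [l [y2l Vl]] := Ty' _ y'y2; exists l; split=> //.
  exact: jonesT1_minimal y2l.
exact: jonesT1_trans b'y' _ (jonesT1_trans y'y2 y2l).
Qed.

(* The set of the [b] for which [jonesT [set b]] has a minimal point in [E] is
   clopen. *)
Lemma minimal_not_split C E : closed C -> closed E -> C `&` E = set0 ->
  L `<=` C `|` E -> (forall c, C c -> jonesT [set c] `<=` C) ->
  (forall e, E e -> jonesT [set e] `<=` E) -> C !=set0 -> E !=set0 -> False.
Proof.
move=> cC cE CE LCE TC TE [c Cc] [e Ee].
pose O : set X := [set b | exists l, [/\ L l, jonesT [set b] l & E l]].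
have CEF x : C x -> E x -> False.
  by move=> Cx Ex; have : (C `&` E) x by []; rewrite CE.
have oO : open O.
  rewrite openE => b [y [Ly by_ Ey]].
  have oC : open (~` C) by exact: closed_openC.
  have : (~` C) y by move=> Cy; exact: CEF Cy Ey.
  move=> /(jonesT1_minimal_lsc Ly by_ oC); apply: filterS => b' [l [Ll b'l Cl]].
  by exists l; split=> //; case: (LCE _ Ll).
have cO : closed O.
  suff -> : O = ~` [set b | jonesT [set b] `<=` ~` (L `&` E)].
    apply: open_closedC; apply: open_jonesT1_sub; apply: closed_openC.
    exact: (closedI closed_minimal cE).
  apply/seteqP; split=> [b [l [Ll bl El]] /(_ l bl)|b]; first by apply.
  apply: contra_notP => nO l bl [Ll El]; apply: nO; by exists l.
have [_ _] := cX; apply: (@splits_not_connected _ setT O (~` O)).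
- by split=> //; [exact: open_closedC|rewrite setICr|rewrite setUv].
- exists e; have [l Ll el] := minimal_exists e; exists l; split=> //.
  exact: TE el.
- by exists c => -[l [_ /(TC _ Cc)]]; exact: CEF.
Qed.

Lemma connected_minimal : connected L.
Proof.
have sat C E c : splits L C E -> C c -> jonesT [set c] `<=` C.
  move=> CE Cc; have [_ _ _ LE] := CE; have Lc : L c by rewrite LE; left.
  apply: (connected_sub_splits CE (connected_jonesT1 hX cX (x := c))).
    exact: jonesT1_minimal.
  by exists c; split=> //; exact: sub_jonesT.
apply: connected_closedP; first exact: closed_minimal.
move=> C E CE; have [cC cE CE0 LE] := CE.
apply: minimal_not_split => //; first by rewrite LE.
  by move=> c; exact: sat CE.
by move=> e; exact: sat (splitsC CE).
Qed.

Lemma connected_setC_interior W : subcontinuum W -> W `<=` ~` L ->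
  connected (~` W°).
Proof.
move=> cW WL; apply: connected_closedP => [|C E CE].
  by apply: open_closedC; exact: open_interior.
have [cC cE CE0 WE] := CE; apply: minimal_not_split => //.
- by rewrite -WE => l Ll /interior_subset/WL.
- by move=> c; exact: jonesT1_sub_splits CE.
- by move=> e; exact: jonesT1_sub_splits (splitsC CE).
Qed.

Lemma jonesT_minimal : jonesT L = setT.
Proof.
apply/seteqP; split=> // p _; apply: contrapT => /jonesT_notin[W [cW pW WL]].
have [q Lq pq] := minimal_exists p.
apply: (setC_interior_not_connected cW pW _ pq); first by move/WL.
exact: connected_setC_interior.
Qed.

(** * Additivity *)

(** The reverse inclusion always holds, by monotonicity. *)
Definition additive_at S x :=
  jonesT (x |` S) `<=` jonesT [set x] `|` jonesT S.

(** Lower semicontinuity keeps a point of [jonesT] of the union near the excess point [y], while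
    upper semicontinuity keeps [jonesT [set x']] away from it. *)
Lemma open_non_additive S : closed S -> open [set x | ~ additive_at S x].
Proof.
move=> cS; rewrite openE => x /existsNP[y /not_implyP[TSy /not_orP[xy Sy]]].
have cTT : closed (jonesT [set x] `|` jonesT S).
  by apply: closedU; exact: closed_jonesT.
have [|U [V [oU oV yU TV UV]]] :=
    separate_closed hX cX (closed_set1 (x := y)) cTT.
  by apply/seteqP; split=> // w [/= -> []].
have Uy : U y by apply: yU.
have nU : nbhs x [set x' | jonesT (x' |` S) `&` U !=set0].
  by apply: open_nbhs_nbhs; split; [exact: open_jonesT_meets|exists y].
have nV : nbhs x [set x' | jonesT [set x'] `<=` V].
  apply: open_nbhs_nbhs; split; first exact: open_jonesT1_sub.
  by move=> z xz; apply: TV; left.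
apply: filterS2 nU nV => x' [z [Tz Uz]] TV' /(_ z Tz) zz.
suff : (U `&` V) z by rewrite UV.
by split=> //; case: zz => [/TV'//|Sz]; apply: TV; right.
Qed.

Lemma open_disconnected S : closed S ->
  open [set x | ~ connected (jonesT (x |` S))].
Proof.
move=> cS; rewrite openE => x.
move=> /(disconnected_splits (@closed_jonesT X _))[C [E [CE [c Cc] [e Ee]]]].
have [cC cE CE0 TE] := CE.
have [U [V [oU oV CU EV UV]]] := separate_closed hX cX cC cE CE0.
have UVF z : U z -> V z -> False.
  by move=> Uz Vz; have : (U `&` V) z by []; rewrite UV.
have nU : nbhs x [set x' | jonesT (x' |` S) `&` U !=set0].
  apply: open_nbhs_nbhs; split; first exact: open_jonesT_meets.
  by exists c; split; [rewrite TE; left|exact: CU].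
have nV : nbhs x [set x' | jonesT (x' |` S) `&` V !=set0].
  apply: open_nbhs_nbhs; split; first exact: open_jonesT_meets.
  by exists e; split; [rewrite TE; right|exact: EV].
have nUV : nbhs x [set x' | jonesT (x' |` S) `<=` U `|` V].
  apply: open_nbhs_nbhs; split; last by rewrite /= TE; exact: setUSS.
  by apply: open_jonesT_sub; exact: openU.
apply: filterS3 nU nV nUV => x' [u [Tu Uu]] [v [Tv Vv]] TUV.
apply: (@splits_not_connected _ _ (jonesT (x' |` S) `\` V)
                                  (jonesT (x' |` S) `\` U)).
- split.
  + by apply: closedI; [exact: closed_jonesT|exact: open_closedC].
  + by apply: closedI; [exact: closed_jonesT|exact: open_closedC].
  + by apply/seteqP; split=> // z [[Tz nVz] [_ nUz]]; case: (TUV z Tz).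
  + apply/seteqP; split=> [z Tz|z [[]|[]]//].
    have [Uz|Vz] := TUV z Tz; [left|right]; split=> // ?; exact: (UVF z).
- by exists u; split=> // /(UVF u Uu).
- by exists v; split=> // /UVF; exact.
Qed.

Lemma splits_meets A C E : splits (jonesT A) C E -> C !=set0 -> A `&` C !=set0.
Proof.
move=> CE [c Cc]; apply: contrapT => /set0P/negP/negPn/eqP AC0.
have := jonesT_splits hX cX (splitsC CE) Cc.
by rewrite AC0 (jonesT0 cX).
Qed.

(** Each piece of a splitting contains exactly one of [x] and [q], and by [jonesT_splits] lies in
    [jonesT] of that point. *)
Lemma disconnected_pair x q : ~ connected (jonesT (x |` [set q])) ->
  additive_at [set q] x /\ ~ jonesT [set q] x.
Proof.
move=> ncon; split; last first.
  move=> qx; apply: ncon; suff -> : jonesT (x |` [set q]) = jonesT [set q].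
    exact: connected_jonesT1.
  apply/seteqP; split; last exact/jonesTS/subsetUr.
  by apply: jonesT_sub => z [/= ->//|]; exact: sub_jonesT.
have [C [E [CE C0 E0]]] := disconnected_splits (@closed_jonesT X _) ncon.
wlog Cx : C E CE C0 E0 / C x.
  move=> h; have [_ _ _ TE] := CE.
  have : jonesT (x |` [set q]) x by apply: sub_jonesT; left.
  by rewrite TE => -[]; [exact: h E0|exact: (h E C (splitsC CE))].
have [z [xqz Ez]] := splits_meets (splitsC CE) E0.
have Eq : E q.
  by case: xqz => /= zE; rewrite zE in Ez => //; case: (splits_disj CE Cx Ez).
have [_ _ _ TE] := CE; rewrite /additive_at TE; apply: setUSS.
- apply: subset_trans (jonesT_splits hX cX (splitsC CE)) _; apply: jonesTS.
  by move=> w [[//|/= ->] Cq]; case: (splits_disj CE Cq Eq).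
- apply: subset_trans (jonesT_splits hX cX CE) _; apply: jonesTS.
  by move=> w [[/= ->|//] Ex]; case: (splits_disj CE Cx Ex).
Qed.

Lemma additive_pairC x q : additive_at [set q] x -> additive_at [set x] q.
Proof. by rewrite /additive_at setUC (setUC (jonesT _)). Qed.

Lemma additive_at_eq S x y : jonesT [set x] = jonesT [set y] ->
  additive_at S x -> additive_at S y.
Proof. by move=> xy; rewrite /additive_at (jonesT_setU1_eq S xy) xy. Qed.

Let nonadditive_with q : set X := [set x | L x /\ ~ additive_at [set q] x].

(** For minimal [x] outside [jonesT [set q]], the sets [jonesT [set x]] and [jonesT [set q]] are
    disjoint, so additivity amounts to disconnectedness, an open condition. *)
Let closed_T_nonadditive q : L q ->
  closed (jonesT [set q] `|` nonadditive_with q).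
Proof.
move=> Lq; have cq := closed_set1 (x := q).
suff -> : jonesT [set q] `|` nonadditive_with q =
    L `&` ~` [set x | ~ connected (jonesT (x |` [set q]))].
  by apply: closedI; [exact: closed_minimal|apply: open_closedC; exact: open_disconnected].
apply/seteqP; split=> [x [qx|[Lx nx]]|x [Lx con]].
- split; first exact: jonesT1_minimal qx.
  by move=> /disconnected_pair[_ /(_ qx)].
- by split=> // /disconnected_pair[].
have [qx|qx] := pselect (jonesT [set q] x); [by left|right].
split=> // addx; apply: con.
apply: (@splits_not_connected _ _ (jonesT [set x]) (jonesT [set q])).
- split; [exact: closed_jonesT|exact: closed_jonesT|exact: minimal_disjoint|].
  apply/seteqP; split=> // z [].
    by apply: jonesTS; exact: subsetUl.
  by apply: jonesTS; exact: subsetUr.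
- by exists x; exact: sub_jonesT.
- by exists q; exact: sub_jonesT.
Qed.

(* If [q] were nonadditive with [b] but additive with [l], points [e] near
   [jonesT [set q]] that are additive with [q] would still be nonadditive with
   [b], and the points nonadditive with both [e] and [q] would form a clopen
   subset of the connected set of minimal points. *)
Lemma additive_dichotomy q b l : L q -> L b -> L l ->
  ~ additive_at [set q] b -> ~ jonesT [set q] l -> ~ additive_at [set q] l.
Proof.
move=> Lq Lb Ll qb ql addl; have cq := closed_set1 (x := q).
pose Eq := L `\` (jonesT [set q] `|` nonadditive_with q).
have EqL : Eq l by split=> // -[|[]].
(* [Eq] is open in [L], and since nonadditivity is open its closure can gain only points of [jonesT
   [set q]]. With no such point it would be clopen in [L]. *)
have [n qn cln] : exists2 n, jonesT [set q] n & closure Eq n.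
  apply: contrapT => nn.
  have cEq : closed Eq.
    move=> x clx.
    have Lx : L x by apply: closed_minimal => U /clx[y [[Ly _] Uy]]; exists y.
    split=> // -[qx|[_ nx]]; first by apply: nn; exists x.
    have [y [[Ly ny] ay]] := clx _ (open_nbhs_nbhs (conj (open_non_additive cq) nx)).
    by apply: ny; right.
  apply: (@splits_not_connected _ L _ Eq _ _ _ connected_minimal).
  - split; [exact: closed_T_nonadditive Lq|exact: cEq|
             by apply/seteqP; split=> // x [Ax [_]]|].
    apply/seteqP; split=> [x Lx|x [[/(jonesT1_minimal Lq)//|[]//]|[]//]].
    by have [Ax|Ax] := pselect ((jonesT [set q] `|` nonadditive_with q) x);
      [left|right].
  - by exists q; left; exact: sub_jonesT.
  - by exists l.
have nb : ~ additive_at [set b] n.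
  move=> nb; apply: qb; apply: additive_pairC.
  exact: additive_at_eq (minimal_eq Lq qn) nb.
have [e [[Le ne] be]] :=
  cln _ (open_nbhs_nbhs (conj (open_non_additive (closed_set1 (x := b))) nb)).
have [qe addqe] : ~ jonesT [set q] e /\ additive_at [set q] e.
  by split; [move=> qe; apply: ne; left|apply: contrapT => qe; apply: ne; right].
pose O := [set x | ~ additive_at [set e] x] `&` [set x | ~ additive_at [set q] x].
have oO : open O by apply: openI; apply: open_non_additive; exact: closed_set1.
(* The right side is closed. Its cross terms vanish because [e] and [q] are inequivalent and
   additive. *)
have PE : L `&` O = (jonesT [set e] `|` nonadditive_with e) `&`
                    (jonesT [set q] `|` nonadditive_with q).
  apply/seteqP; split=> [x [Lx [ex qx]]|x [[ex|[Lx ex]] [qx|[Lx' qx]]]].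
  - by split; right.
  - by case: qe; exact: jonesT1_trans qx _ (Le _ ex).
  - by case: qx; exact: additive_at_eq (esym (minimal_eq Le ex)) addqe.
  - case: ex; apply: additive_at_eq (esym (minimal_eq Lq qx)) _.
    exact: additive_pairC.
  - by [].
apply: (@splits_not_connected _ L (L `&` O) (L `&` ~` O) _ _ _ connected_minimal).
- split.
  + by rewrite PE; apply: closedI; exact: closed_T_nonadditive.
  + by apply: closedI; [exact: closed_minimal|exact: open_closedC].
  + by rewrite setIACA setICr setI0.
  + by rewrite -setIUr setUv setIT.
- by exists b; split=> //; split=> // eb; apply: be; exact: additive_pairC.
- by exists e; split=> // -[_].
Qed.

Lemma exists_additive_pair p : ~ L p -> exists q l,
  [/\ L q, L l, ~ jonesT [set q] l & additive_at [set q] l].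
Proof.
move=> Lp; have [q Lq pq] := minimal_exists p.
have : ~ jonesT [set q] p by move=> /(jonesT1_minimal Lq).
move=> /jonesT_notin[W [cW pW Wq]].
have nWq : ~ W q by move=> /Wq; apply.
have Wq' : (~` W°) q by move=> /interior_subset.
have ncon := setC_interior_not_connected cW pW nWq pq.
have [|C [E [CE C0 E0]]] := disconnected_splits _ ncon.
  by apply: open_closedC; exact: open_interior.
wlog Cq : C E CE C0 E0 / C q.
  move=> h; have [_ _ _ WE] := CE; move: (Wq'); rewrite WE => -[].
    exact: (h C E).
  exact: (h E C (splitsC CE)).
(* The piece [E] contains [jonesT [set e]], hence the minimal point [l]; then [q] and [l] lie in
   different pieces, which disconnects [jonesT] of the pair. *)
have [e Ee] := E0; have [l Ll el] := minimal_exists e.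
have El : E l := jonesT1_sub_splits cW (splitsC CE) Ee el.
have [cC cE CE0 WE] := CE.
have Wl : (~` W°) l by rewrite WE; right.
have TW : jonesT (l |` [set q]) `<=` ~` W°.
  by apply: jonesT_subC => // z [] ->.
have [|addl ql] := @disconnected_pair l q; last by exists q, l.
apply: (@splits_not_connected _ _ (jonesT (l |` [set q]) `&` C)
                                  (jonesT (l |` [set q]) `&` E)).
- split; [by apply: closedI => //; exact: closed_jonesT|
          by apply: closedI => //; exact: closed_jonesT|
          by rewrite setIACA CE0 setI0|].
  by rewrite -setIUr -WE; apply/esym/setIidPl.
- by exists q; split=> //; apply: sub_jonesT; right.
- by exists l; split=> //; apply: sub_jonesT; left.
Qed.

(** The dichotomy is applied twice: at [q] it makes every minimal point additive with [q]; at [c],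
    with [q] as the additive partner, it reaches [a]. *)
Lemma minimal_pairs_additive p a c : ~ L p -> L a -> L c ->
  additive_at [set c] a.
Proof.
move=> /exists_additive_pair[q [l [Lq Ll ql addl]]] La Lc.
have qadd b : L b -> additive_at [set q] b.
  by move=> Lb; apply: contrapT => nb; exact: additive_dichotomy nb ql addl.
apply: contrapT => nac; have [cq|cq] := pselect (jonesT [set c] q).
  apply: nac; apply: additive_pairC.
  apply: additive_at_eq (minimal_eq Lc cq) _.
  by apply: additive_pairC; exact: qadd.
have := additive_dichotomy Lc La Lq nac cq; apply; apply: additive_pairC.
exact: qadd.
Qed.

(** Serves induction on length: the entries of [s] in [C] suffice for [C], and at least one entry
    lies in [E]. *)
Lemma seq_splits_jonesT (s : seq X) C E : splits (jonesT [set` s]) C E ->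
  E !=set0 -> exists s' : seq X, [/\ (size s' < size s)%N,
    [set` s'] `<=` [set` s] & C `<=` jonesT [set` s']].
Proof.
move=> CE E0; exists [seq y <- s | `[< C y >]]; split.
- have [y [ys Ey]] := splits_meets (splitsC CE) E0.
  rewrite size_filter -(count_predC (fun y => `[< C y >])) -addn1 leq_add2l.
  rewrite -has_count; apply/hasP; exists y => //=.
  by apply/asboolPn => Cy; exact: splits_disj CE Cy Ey.
- by move=> y /=; rewrite mem_filter => /andP[].
- apply: subset_trans (jonesT_splits hX cX (splitsC CE)) _; apply: jonesTS.
  by move=> y [ys Cy] /=; rewrite mem_filter ys andbT; exact/asboolP.
Qed.

(* For a list [s] with two inequivalent entries, the [x] for which
   [jonesT (x |` [set` s])] is disconnected are those additive with [s], so they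
   form a clopen subset of the connected set of minimal points. *)
Lemma jonesT_seq_additive (s : seq X) :
  (forall a c, L a -> L c -> additive_at [set c] a) -> [set` s] `<=` L ->
  jonesT [set` s] `<=` \bigcup_(a in [set` s]) jonesT [set a].
Proof.
move=> addL; move: {2}(size s) (leqnn (size s)) => n.
elim: n s => [|n ih] [|l s] sn sL //.
- by rewrite set_nil (jonesT0 cX).
- by rewrite set_nil (jonesT0 cX).
have Ll : L l by apply: sL; rewrite /= mem_head.
have sL' : [set` s] `<=` L by move=> y ys; apply: sL; rewrite /= inE ys orbT.
have addls : additive_at [set` s] l -> jonesT [set` l :: s] `<=`
    \bigcup_(a in [set` l :: s]) jonesT [set a].
  rewrite set_seq_cons => add; apply: subset_trans add _.
  move=> x [lx|/(ih s sn sL')[a sa ax]]; first by exists l => //; left.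
  by exists a => //; right.
apply: addls.
have [s0|[a0 sa0]] : s = [::] \/ exists a, a \in s.
  by case: (s) => [|a ?]; [left|right; exists a; rewrite mem_head].
  by rewrite s0 /additive_at set_nil setU0; exact: subsetUl.
(* If one [jonesT [set a]] contains all of [s], additivity of the pair [l], [a] suffices. *)
have [[a sa ha]|nha] :=
    pselect (exists2 a, a \in s & forall c, c \in s -> jonesT [set a] c).
  have : jonesT (l |` [set` s]) `<=` jonesT (l |` [set a]).
    apply: jonesT_sub => z [/= ->|/ha]; first by apply: sub_jonesT; left.
    by apply: jonesTS; exact: subsetUr.
  move=> /subset_trans; apply.
  apply: subset_trans (addL _ _ Ll (sL' _ sa)) _; apply: setUS.
  by apply: jonesTS => _ ->.
have [c sc ac] : exists2 c, c \in s & ~ jonesT [set a0] c.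
  apply: contrapT => nc; apply: nha; exists a0 => // c sc.
  by apply: contrapT => ac; apply: nc; exists c.
have cs := closed_seq (s := s).
have TaS a : a \in s -> jonesT [set a] `<=` jonesT [set` s].
  by move=> sa; apply: jonesTS => _ ->.
(* Additivity and induction present the set as a union of classes; the class of [a0] is split off
   from the others, among which is that of [c]. *)
have disc x : L x -> additive_at [set` s] x ->
    ~ connected (jonesT (x |` [set` s])).
  move=> Lx addx.
  pose r := [seq y <- x :: s | ~~ `[< jonesT [set a0] y >]].
  pose E := \big[setU/set0]_(y <- r) jonesT [set y].
  have Er z : E z <-> exists2 y, y \in r & jonesT [set y] z.
    by rewrite /E -bigcup_seq.
  have Lr y : y \in r -> [/\ L y, ~ jonesT [set a0] y & (x |` [set` s]) y].
    rewrite mem_filter => /andP[/asboolPn ay]; rewrite inE => /orP[/eqP yx|ys].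
      by split=> //; [rewrite yx|left].
    by split=> //; [exact: sL'|right].
  apply: (@splits_not_connected _ _ (jonesT [set a0]) E).
  - split.
    + exact: closed_jonesT.
    + by apply: closed_bigsetU => y _; exact: closed_jonesT.
    + apply/seteqP; split=> // z [az /Er[y /Lr[Ly ay _] yz]].
      by rewrite -(minimal_disjoint Ly ay).
    + apply/seteqP; split=> [z Tz|z [|/Er[y /Lr[_ _ xsy]]]].
      * have [y xsy yz] : exists2 y, y \in x :: s & jonesT [set y] z.
          have [xz|/(ih s sn sL')[y ys yz]] := addx _ Tz.
            by exists x; rewrite ?mem_head.
          by exists y; rewrite // inE ys orbT.
        have [ay|ay] := pselect (jonesT [set a0] y); [left|right].
          exact: jonesT1_trans yz.
        by apply/Er; exists y => //; rewrite mem_filter xsy andbT; exact/asboolPn.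
      * by apply: jonesTS => _ ->; right.
      * by apply: jonesTS => _ ->.
  - by exists a0; exact: sub_jonesT.
  - exists c; apply/Er; exists c; last exact: sub_jonesT.
    by rewrite mem_filter inE sc orbT andbT; exact/asboolPn.
have add x : L x -> ~ connected (jonesT (x |` [set` s])) ->
    additive_at [set` s] x.
  move=> Lx.
  move=> /(disconnected_splits (@closed_jonesT X _))[C [E [CE C0 E0]]].
  (* Dropping an entry of [x :: s] leaves at most [n] of them, so the induction hypothesis applies
     to each piece. *)
  have half C' E' : splits (jonesT (x |` [set` s])) C' E' -> E' !=set0 ->
      C' `<=` jonesT [set x] `|` jonesT [set` s].
    rewrite -set_seq_cons => CE' E0'.
    have [s' [ss' s's Cs']] := seq_splits_jonesT CE' E0'.
    have s'L : [set` s'] `<=` L.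
      by move=> y /s's /=; rewrite inE => /orP[/eqP ->//|]; exact: sL'.
    apply: subset_trans Cs' _.
    have s'n : (size s' <= n)%N by rewrite -ltnS (leq_trans ss').
    apply: subset_trans (ih s' s'n s'L) _.
    move=> z [y /s's /=]; rewrite inE => /orP[/eqP ->|/TaS ys yz]; first by left.
    by right; exact: ys.
  have [_ _ _ TE] := CE; rewrite /additive_at TE => z [|].
    exact: half CE E0 z.
  exact: half (splitsC CE) C0 z.
apply: contrapT => nadd.
pose O := [set x | ~ additive_at [set` s] x].
have oO : open O by exact: open_non_additive.
have OE : L `&` O = L `&` ~` [set x | ~ connected (jonesT (x |` [set` s]))].
  apply/seteqP; split=> x [Lx nx]; split=> //; first by move/(add x Lx).
  by move=> /(disc x Lx).
apply: (@splits_not_connected _ L (L `&` O) (L `&` ~` O) _ _ _ connected_minimal).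
- split.
  + rewrite OE; apply: closedI; first exact: closed_minimal.
    by apply: open_closedC; exact: open_disconnected.
  + by apply: closedI; [exact: closed_minimal|exact: open_closedC].
  + by rewrite setIACA setICr setI0.
  + by rewrite -setIUr setUv setIT.
- by exists l.
(* Adjoining [a0], already an entry of [s], changes nothing, so [a0] is additive with [s]. *)
- exists a0; split; first exact: sL'.
  apply; rewrite /additive_at.
  suff -> : a0 |` [set` s] = [set` s] by exact: subsetUr.
  by apply/setUidPr => _ ->.
Qed.

(** * All points are minimal: the partition of the continuum *)

Lemma minimal_setT : L = setT.
Proof.
apply/seteqP; split=> // p _; apply: contrapT => Lp.
have addL a c : L a -> L c -> additive_at [set c] a.
  exact: minimal_pairs_additive Lp.
have [|||||s sL [x [sx Lx]]] := @jonesT_finite L L (~` L).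
- exact: closed_minimal.
- by [].
- exact: subset_closure.
- by apply: closed_openC; exact: closed_minimal.
- by rewrite jonesT_minimal setTI; exists p.
apply: Lx; have [a sa ax] := jonesT_seq_additive addL sL sx.
exact: jonesT1_minimal (sL _ sa) _ ax.
Qed.

Lemma jonesT1_sym (x y : X) : jonesT [set x] y -> jonesT [set y] x.
Proof. by have : L x by [rewrite minimal_setT]; apply. Qed.

Lemma jonesT1_interior_setT (p : X) : (jonesT [set p])° !=set0 ->
  jonesT [set p] = setT.
Proof.
move=> [v pv]; have oT : open (jonesT [set p]).
  rewrite openE => z pz.
  (* For [z'] near [z], [jonesT [set z']] meets the interior of [jonesT [set p]], and symmetry puts
     [z'] in [jonesT [set p]]. *)
  have := open_jonesT1_meets (@open_interior _ (jonesT [set p])).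
  rewrite openE => /(_ z); rewrite /interior /= => h; apply: filterS (h _).
    move=> z' [y [z'y /interior_subset py]].
    exact: jonesT1_trans py _ (jonesT1_sym z'y).
  exists v; split=> //; apply: jonesT1_trans (jonesT1_sym pz) _ _.
  exact: interior_subset.
apply/seteqP; split=> // x _; apply: contrapT => px; have [_ _] := cX.
apply: (@splits_not_connected _ setT (jonesT [set p]) (~` jonesT [set p])).
- by split; [exact: closed_jonesT|exact: open_closedC|rewrite setICr|rewrite setUv].
- by exists p; exact: sub_jonesT.
- by exists x.
Qed.

Lemma decomposable_jonesT1 (p : X) : decomposable X -> (jonesT [set p])° = set0.
Proof.
move=> [U [V [cU cV UT VT UV]]]; apply: contrapT => /eqP/set0P.
move=> /jonesT1_interior_setT Tp.
have [b Ub] : exists b, ~ U b.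
  by apply: contrapT => /forallNP nU; apply/negP: UT; rewrite negbK; apply/eqP/seteqP;
    split=> // x _; exact: contrapT (nU x).
have [x Vx] : exists x, ~ V x.
  by apply: contrapT => /forallNP nV; apply/negP: VT; rewrite negbK; apply/eqP/seteqP;
    split=> // x _; exact: contrapT (nV x).
(* By symmetry [jonesT [set b]] is everything too, yet [U] misses [b] and contains the open
   complement of [V], where [x] lies. *)
have Tb : jonesT [set b] x.
  have bp : jonesT [set b] p by apply: jonesT1_sym; rewrite Tp.
  by apply: jonesT1_trans bp _ _; rewrite Tp.
suff : ~ jonesT [set b] x by []; apply/jonesT_notin; exists U; split=> //.
  have : open (~` V) by apply: closed_openC; exact: subcontinuum_closed.
  rewrite openE => /(_ x Vx); apply: interiorS => y Vy.
  by have : (U `|` V) y by [rewrite UV]; case.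
by move=> y Uy /= yb; apply: Ub; rewrite -yb.
Qed.

End hyperspace_continuity.

(** * Decomposability *)

(** In a splitting into [P] and [Q] with [W] inside [P], the piece [Q] lies in [C], hence is
    disjoint from [E]; so [Q] and the union of [P] and [E] would split the whole space. *)
Lemma subcontinuum_setU_splits (X : topologicalType) (W C E : set X) :
  hausdorff_space X -> subcontinuum [set: X] -> subcontinuum W ->
  splits (~` W°) C E -> subcontinuum (W `|` C).
Proof.
move=> hX cX cW CE; have [[w Ww] _ conW] := cW; have [cC cE CE0 WE] := CE.
have clW := subcontinuum_closed hX cW.
have clWC : closed (W `|` C) by exact: closedU.
apply: closed_subcontinuum => //; first by exists w; left.
apply: connected_closedP => //.
move=> P Q PQ P0 Q0; wlog Pw : P Q PQ P0 Q0 / P w.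
  move=> h; have [_ _ _ WC] := PQ; have : (W `|` C) w by left.
  by rewrite WC => -[]; [exact: (h P Q)|exact: (h Q P (splitsC PQ))].
have [cP cQ PQ0 WC] := PQ.
have WP : W `<=` P.
  apply: (connected_sub_splits PQ conW); first exact: subsetUl.
  by exists w.
have QC : Q `<=` C.
  move=> q Qq; have : (W `|` C) q by rewrite WC; right.
  by case=> // /WP Pq; case: (splits_disj PQ Pq Qq).
have [_ _] := cX; apply: (@splits_not_connected _ setT (P `|` E) Q) => //.
- split=> //; first exact: closedU.
    rewrite setIUl PQ0 set0U; apply/seteqP; split=> // x [Ex /QC Cx].
    exact: splits_disj CE Cx Ex.
  apply/seteqP; split=> // x _.
  have [Wx|] := pselect (W° x); first by left; left; exact: WP _ (interior_subset Wx).
  rewrite -[~ _]/((~` W°) x) WE => -[Cx|]; last by left; right.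
  have : (W `|` C) x by right.
  by rewrite WC => -[]; [left; left|right].
- by exists w; left.
Qed.

Lemma decomposable_subcontinuum (X : topologicalType) (W : set X) :
  hausdorff_space X -> subcontinuum [set: X] -> subcontinuum W ->
  W != setT -> W° !=set0 -> decomposable X.
Proof.
move=> hX cX cW WT [x xW].
have [p Wp] : exists p, ~ W p.
  by apply: contrapT => /forallNP nW; apply/negP: WT; rewrite negbK; apply/eqP/seteqP;
    split=> // y _; exact: contrapT (nW y).
have cWi : closed (~` W°) by apply: open_closedC; exact: open_interior.
have WWi : W `|` ~` W° = setT.
  apply/seteqP; split=> // y _; have [/interior_subset|] := pselect (W° y); first by left.
  by right.
have [con|ncon] := pselect (connected (~` W°)).
  exists W, (~` W°); split=> //.
  - by apply: closed_subcontinuum => //; exists p => /interior_subset.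
  - apply/eqP => WiT; have : (~` W°) x by rewrite WiT.
    exact.
have [C [E [CE C0 E0]]] := disconnected_splits cWi ncon.
(* A point of [E'] is in the closure of the complement of [W] and off the closed [C'], so points
   near it lie outside both [W] and [C']. *)
have proper C' E' : splits (~` W°) C' E' -> E' !=set0 -> W `|` C' != setT.
  move=> CE' [e Ee]; have [cC cE CE0 WE] := CE'; apply/eqP => WC.
  have : closure (~` W) e by rewrite closure_setC WE; right.
  have nC : (~` C') e by move=> Ce; exact: splits_disj CE' Ce Ee.
  move=> /(_ _ (open_nbhs_nbhs (conj (closed_openC cC) nC)))[y [Wy Cy]].
  by have : (W `|` C') y by [rewrite WC]; case.
exists (W `|` C), (W `|` E); split.
- exact: subcontinuum_setU_splits CE.
- exact: subcontinuum_setU_splits (splitsC CE).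
- exact: proper CE E0.
- exact: proper (splitsC CE) C0.
- by have [_ _ _ WE] := CE; rewrite setUACA setUid -WE.
Qed.

Theorem corollary3p13 (R : realType) (X : metricType R) (cX : continuum X)
    (continuousT : continuous (hyperT cX)) :
  decomposable X <-> forall p : X, (jonesT [set p])° = set0.
Proof.
split=> [decX p|T0]; first exact: decomposable_jonesT1.
have [[p _] _ _] := cX.
(* The witness for such an [x] is a subcontinuum with interior, and it is proper since it misses
   [p]. *)
have [x Tx] : exists x, ~ jonesT [set p] x.
  apply: contrapT => /forallNP Tp.
  have : (jonesT [set p])° p by apply: filterS filterT => x _; exact: contrapT (Tp x).
  by rewrite T0.
move/jonesT_notin: Tx => [W [cW xW Wp]].
apply: (decomposable_subcontinuum (@metric_hausdorff _ X) cX cW); last by exists x.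
apply/eqP => WT; have /Wp : W p by rewrite WT.
exact.
Qed.
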